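(* (1) $\mathcal{G}_{aaa}$ is a subalgebra of $\mathcal{G}_{\mathcal{B}}$ stable under translation and derivation. (2) $\mathcal{G}_{aaa}\times\mathcal{G}_{aa}\subset\mathcal{G}_{aaa}$, i.e. $\widetilde{u}\times\widetilde{v}\in\mathcal{G}_{aaa}$ for all $\widetilde{u}\in\mathcal{G}_{aaa}$, $\widetilde{v}\in\mathcal{G}_{aa}$. (3) $\mathcal{G}_{aaa}*\mathcal{G}_{L^1}\subset\mathcal{G}_{aaa}$, i.e. $\widetilde{u}*\widetilde{v}\in\mathcal{G}_{aaa}$ for all $\widetilde{u}\in\mathcal{G}_{aaa}$, $\widetilde{v}\in\mathcal{G}_{L^1}$.
   Context: Notation: $\mathbb{Z}_+=\{0,1,2,\dots\}$, $I:=\,]0,1]$, $\mathbb{J}:=[0,+\infty[$. All functions are complex-valued. $\mathcal{C}_b$ is the space of bounded continuous functions on $\mathbb{R}$. A continuous function $g$ on $\mathbb{R}$ is almost automorphic if every real sequence $(s_m)$ has a subsequence $(s_{m_k})_k$ such that $\tilde g(x):=\lim_{k}g(x+s_{m_k})$ exists for every $x\in\mathbb{R}$ and $\lim_k\tilde g(x-s_{m_k})=g(x)$ for every $x\in\mathbb{R}$; $\mathcal{C}_{aa}$ is the space of such functions. $\mathcal{C}_{+,0}$ is the space of $h\in\mathcal{C}_b$ with $\lim_{x\to+\infty}h(x)=0$. $\mathcal{C}_{aaa}$ is the space of $f\in\mathcal{C}_b$ for which there are $g\in\mathcal{C}_{aa}$, $h\in\mathcal{C}_{+,0}$ with $f=g+h$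 on $\mathbb{J}$. $\mathcal{D}_{L^p}(\mathbb{R})$ is the space of smooth functions on $\mathbb{R}$ all of whose derivatives lie in $L^p(\mathbb{R})$, with $|\varphi|_{k,p,\mathbb{R}}:=\sum_{j\le k}\|\varphi^{(j)}\|_{L^p(\mathbb{R})}$; $\mathcal{B}:=\mathcal{D}_{L^\infty}(\mathbb{R})$. $\mathcal{B}_{aa}$ (resp. $\mathcal{B}_{aaa}$) is the space of smooth functions on $\mathbb{R}$ all of whose derivatives (including order $0$) lie in $\mathcal{C}_{aa}$ (resp. $\mathcal{C}_{aaa}$). For $X\subset\mathcal{D}_{L^p}(\mathbb{R})$ (with $p=\infty$ for $X=\mathcal{B}_{aaa},\mathcal{B}_{aa},\mathcal{B}$ and $p=1$ for $X=\mathcal{D}_{L^1}(\mathbb{R})$), let $\mathcal{M}_X$ be the set of nets $(u_\varepsilon)_{\varepsilon\in I}\in X^I$ such that $\forall k\in\mathbb{Z}_+\,\exists m\in\mathbb{Z}_+$: $|u_\varepsilon|_{k,p,\mathbb{R}}=O(\varepsilon^{-m})$, $\varepsilon\to0$, and $\mathcal{N}_X$ the set of nets in $X^I$ such that $\forall k,m\in\mathbb{Z}_+$: $|u_\varepsilon|_{k,p,\mathbb{R}}=O(\varepsilon^{m})$, $\varepsilon\to0$. Set $\mathcal{G}_X:=\mathcal{M}_X/\mathcal{N}_X$; then $\mathcal{G}_{aaa},\mathcal{G}_{aa},\mathcal{G}_{\mathcal{B}},\mathcal{G}_{L^1}$ are the quotients for $X=\mathcal{B}_{aaa},\mathcal{B}_{aa},\mathcal{B},\mathcal{D}_{L^1}(\mathbb{R})$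 respectively. Operations are defined on representatives: for $\widetilde{u}=[(u_\varepsilon)_\varepsilon]\in\mathcal{G}_{\mathcal{B}}$, $\tau_\omega\widetilde{u}:=[(u_\varepsilon(\cdot+\omega))_\varepsilon]$ for $\omega\in\mathbb{R}$, $\widetilde{u}^{(j)}:=[(u_\varepsilon^{(j)})_\varepsilon]$ for $j\in\mathbb{Z}_+$, $\widetilde{u}\times\widetilde{v}:=[(u_\varepsilon v_\varepsilon)_\varepsilon]$ for $\widetilde{v}=[(v_\varepsilon)_\varepsilon]\in\mathcal{G}_{\mathcal{B}}$, and $\widetilde{u}*\widetilde{v}:=[(u_\varepsilon*v_\varepsilon)_\varepsilon]$ for $\widetilde{v}=[(v_\varepsilon)_\varepsilon]\in\mathcal{G}_{L^1}$. *)

(* Defs.v *)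
From HB Require Import structures.
From mathcomp Require Import all_boot all_order all_algebra.
From mathcomp Require Import all_classical all_reals all_analysis.
From mathcomp Require Import complex.

Set Implicit Arguments.
Unset Strict Implicit.
Unset Printing Implicit Defensive.

Import Order.TTheory GRing.Theory Num.Theory.
Import numFieldNormedType.Exports.

Local Open Scope ring_scope.
Local Open Scope classical_set_scope.

(* [Rcomplex R] is the field of complex numbers with its real-valued modulus
   and its structure of vector space over [R]. It is made a normed module over
   [R] here, so that limits, continuity and the iterated derivatives [f^`(n)]
   of functions [R -> Rcomplex R] are those of the library. *)
Section Rcomplex_normedModType.
Variable R : realType.

HB.instance Definition _ :=
  PseudoMetric.copy (Rcomplex R) (pseudoMetric_normed (Rcomplex R)).
HB.instance Definition _ := isPointed.Build (Rcomplex R) 0.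
HB.instance Definition _ :=
  NormedZmod_PseudoMetric_eq.Build R (Rcomplex R) erefl.

Lemma Rcomplex_normrZ (l : R) (x : Rcomplex R) : `|l *: x| = `|l| * `|x|.
Proof.
case: x => a b; rewrite /Num.norm/= !exprMn -mulrDr sqrtrM ?sqr_ge0//.
by rewrite sqrtr_sqr.
Qed.

HB.instance Definition _ :=
  PseudoMetricNormedZmod_Lmodule_isNormedModule.Build R (Rcomplex R)
    Rcomplex_normrZ.

End Rcomplex_normedModType.

Section FunctionSpaces.
Variable R : realType.
Local Notation C := (Rcomplex R).
Implicit Types (f g h : R -> C) (p : \bar R).

Definition Cb : set (R -> C) := [set f | continuous f /\ bounded_fun f].

Definition Caa : set (R -> C) := [set g | continuous g /\
  forall s : nat -> R, exists (k : nat -> nat) (g' : R -> C),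
    [/\ increasing_seq k,
        forall x, (fun n => g (x + s (k n))) @ \oo --> g' x
      & forall x, (fun n => g' (x - s (k n))) @ \oo --> g x]].

Definition Cplus0 : set (R -> C) :=
  [set h | Cb h /\ h x @[x --> +oo%R] --> (0 : C)].

Definition Caaa : set (R -> C) := [set f | Cb f /\
  exists g h, [/\ Caa g, Cplus0 h & forall x, 0 <= x -> f x = g x + h x]].

Definition smooth : set (R -> C) :=
  [set f | forall j x, derivable (f^`(j)) x 1].

Definition LpNorm p f : \bar R :=
  Lnorm (@lebesgue_measure R) p (fun x => (`|f x|)%:E).

(* Measurability of the derivatives follows from their continuity. *)
Definition DLp p : set (R -> C) :=
  [set f | smooth f /\ forall j, (LpNorm p (f^`(j)) < +oo)%E].

Definition DLp_norm p (k : nat) f : \bar R :=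
  (\sum_(0 <= j < k.+1) LpNorm p (f^`(j)))%E.

Definition B : set (R -> C) := DLp +oo%E.

Definition Baa : set (R -> C) :=
  [set f | smooth f /\ forall j, Caa (f^`(j))].

Definition Baaa : set (R -> C) :=
  [set f | smooth f /\ forall j, Caaa (f^`(j))].

Definition translate (w : R) f : R -> C := fun x => f (x + w).

(* Real and imaginary parts of the Lebesgue integral of f (x - y) * g y. *)
Definition convolution f g : R -> C := fun x =>
  Complex (\int[@lebesgue_measure R]_y complex.Re (f (x - y) * g y))
          (\int[@lebesgue_measure R]_y complex.Im (f (x - y) * g y)).

End FunctionSpaces.

Section GeneralizedFunctions.
Variable R : realType.
Local Notation C := (Rcomplex R).

Definition Ieps : Type := set_type `]0%R, 1%R : R]%classic.

Definition net : Type := Ieps -> R -> C.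
Implicit Types (X : set (R -> C)) (p : \bar R) (u v w : net).

(* a e = O(e ^ m) as e tends to 0. *)
Definition bigO_eps (a : Ieps -> \bar R) (m : int) : Prop :=
  exists K d : R, 0 < d /\
    forall e : Ieps, val e < d -> (a e <= (K * val e ^ m)%:E)%E.

Definition moderate p X : set net := [set u | (forall e, X (u e)) /\
  forall k : nat, exists m : nat,
    bigO_eps (fun e => DLp_norm p k (u e)) (- m%:Z)].

Definition negligible_net p X : set net := [set u | (forall e, X (u e)) /\
  forall k m : nat, bigO_eps (fun e => DLp_norm p k (u e)) m%:Z].

(* The class of [u] modulo the negligible nets, as a set of nets. *)
Definition net_class p X u : set net :=
  [set w | negligible_net p X (fun e x => w e x - u e x)].

Definition quotient_space p X : set (set net) :=
  [set net_class p X u | u in moderate p X].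

Definition G_B := quotient_space +oo%E (@B R).
Definition G_aa := quotient_space +oo%E (@Baa R).
Definition G_aaa := quotient_space +oo%E (@Baaa R).
Definition G_L1 := quotient_space 1%E (DLp 1%E).

(* Operations with values in [G_B], defined on representatives: the union of
   the classes of [F u] (resp. [F u v]) over all representatives. Classes are
   nonempty, and equal or disjoint, so that this union is an element of [G_B]
   exactly when every [F u] is moderate and its class does not depend on the
   representatives chosen; membership in [G_B] thus includes the fact that the
   operation is well defined. *)
Definition on_class (F : net -> net) (U : set net) : set net :=
  \bigcup_(u in U) net_class +oo%E (@B R) (F u).

Definition on_class2 (F : net -> net -> net) (U V : set net) : set net :=
  \bigcup_(u in U) \bigcup_(v in V) net_class +oo%E (@B R) (F u v).

(* The canonical map [u] |-> [u] to [G_B] from [G_aa] or [G_aaa], a class of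
   which is smaller than the class of the same net in [G_B]. *)
Definition to_GB (U : set net) : set net := on_class id U.

Definition gone : set net := net_class +oo%E (@B R) (fun _ _ => 1).
Definition gadd := on_class2 (fun u v e x => u e x + v e x).
Definition gmul := on_class2 (fun u v e x => u e x * v e x).
Definition gscale (c : C) := on_class (fun u e x => c * u e x).
Definition gtranslate (t : R) := on_class (fun u e => translate t (u e)).
Definition gderive (j : nat) := on_class (fun u e => (u e)^`(j)).
Definition gconv := on_class2 (fun u v e => convolution (u e) (v e)).

Definition subalgebra_GB (S : set (set net)) : Prop :=
  [/\ S `<=` G_B,
      S gone,
      forall U V, S U -> S V -> S (gadd U V),
      forall c U, S U -> S (gscale c U)
    & forall U V, S U -> S V -> S (gmul U V)].

End GeneralizedFunctions.

Arguments G_B R : clear implicits.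
Arguments G_aa R : clear implicits.
Arguments G_aaa R : clear implicits.
Arguments G_L1 R : clear implicits.
Arguments to_GB {R} U.

(* Main.v *)
Require Import Defs.
From mathcomp Require Import all_boot all_order all_algebra.
From mathcomp Require Import all_classical all_reals all_analysis.
From mathcomp Require Import measurable_realfun ess_sup_inf.
From mathcomp Require Import complex ring zify.

(* Everything reduces to two facts. First, all the operations act on the tower
   of derivatives of a function: sums, translations and convolutions termwise,
   products by Leibniz's rule. Hence a space cut out by a condition on each
   derivative inherits the closure properties of that condition, and so do
   moderateness and negligibility, which for continuous derivatives are bounds
   O(e^m) uniform in x. Secondly, C_aaa is an algebra that is stable under
   translation and convolution with L^1: on all of R an element of C_aaa is the
   sum of an almost automorphic function and a function of C_{+,0}; successive
   subsequences handle sums and products of the first summands, almost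
   automorphic functions are bounded, and dominated convergence handles
   convolution with both summands. *)

Set Implicit Arguments.
Unset Strict Implicit.
Unset Printing Implicit Defensive.

Import Order.TTheory GRing.Theory Num.Theory.
Import numFieldNormedType.Exports.

Local Open Scope ring_scope.
Local Open Scope classical_set_scope.

Local Notation Re := complex.Re.
Local Notation Im := complex.Im.

(** * Limits and derivatives of complex-valued functions, part by part *)

Section ComplexLimits.
Variable R : realType.
Local Notation C := (Rcomplex R).
Implicit Types (z w : C).

Lemma cReD z w : Re (z + w) = Re z + Re w. Proof. by case: z w => ? ? []. Qed.
Lemma cImD z w : Im (z + w) = Im z + Im w. Proof. by case: z w => ? ? []. Qed.
Lemma cReB z w : Re (z - w) = Re z - Re w. Proof. by case: z w => ? ? []. Qed.
Lemma cImB z w : Im (z - w) = Im z - Im w. Proof. by case: z w => ? ? []. Qed.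
Lemma cReM z w : Re (z * w) = Re z * Re w - Im z * Im w.
Proof. by case: z w => ? ? []. Qed.
Lemma cImM z w : Im (z * w) = Re z * Im w + Im z * Re w.
Proof. by case: z w => ? ? []. Qed.
Lemma cReZ (a : R) z : Re (a *: z) = a * Re z. Proof. by case: z. Qed.
Lemma cImZ (a : R) z : Im (a *: z) = a * Im z. Proof. by case: z. Qed.

Lemma normRcomplexM z w : @Num.norm R C (z * w) = `|z| * `|w|.
Proof. exact: Normc.normcM. Qed.

Lemma normCE z : `|z| = Num.sqrt (Re z ^+ 2 + Im z ^+ 2).
Proof. by case: z. Qed.

Lemma normC_Re z : `|Re z| <= `|z|.
Proof.
by rewrite normCE -sqrtr_sqr ler_sqrt ?lerDl ?addr_ge0 ?sqr_ge0.
Qed.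

Lemma normC_Im z : `|Im z| <= `|z|.
Proof.
by rewrite normCE -sqrtr_sqr ler_sqrt ?lerDr ?addr_ge0 ?sqr_ge0.
Qed.

Lemma normC_le z : `|z| <= `|Re z| + `|Im z|.
Proof.
rewrite normCE -[leRHS]ger0_norm ?addr_ge0// -sqrtr_sqr ler_sqrt ?sqr_ge0//.
by rewrite sqrrD !real_normK ?num_real// addrAC lerDl mulrn_wge0 ?mulr_ge0.
Qed.

(** Each part is bounded by the modulus, and the modulus by the sum of the parts. Real limit
    theorems reach [C] through this equivalence. *)
Lemma cvgC_P T (F : set_system T) {FF : Filter F} (f : T -> C) (l : C) :
  f x @[x --> F] --> l <->
  Re (f x) @[x --> F] --> Re l /\ Im (f x) @[x --> F] --> Im l.
Proof.
split=> [/cvgrPdist_le fl|[/cvgrPdist_le fl1 /cvgrPdist_le fl2]].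
  split; apply/cvgrPdist_le => e /fl; apply: filterS => x; apply: le_trans.
    by rewrite -cReB normC_Re.
  by rewrite -cImB normC_Im.
apply/cvgrPdist_le => e e0.
have e20 : 0 < e / 2 by rewrite divr_gt0.
apply: filterS2 (fl1 _ e20) (fl2 _ e20) => x h1 h2.
rewrite (le_trans (normC_le _))// cReB cImB (splitr e).
exact: lerD.
Qed.

Lemma cvgCM T (F : set_system T) {FF : Filter F} (f g : T -> C) (a b : C) :
  f x @[x --> F] --> a -> g x @[x --> F] --> b ->
  f x * g x @[x --> F] --> a * b.
Proof.
move=> /cvgC_P[fa1 fa2] /cvgC_P[ga1 ga2]; apply/cvgC_P.
rewrite cReM cImM; split.
  under eq_fun do rewrite cReM; apply: cvgB; exact: cvgM.
under eq_fun do rewrite cImM; apply: cvgD; exact: cvgM.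
Qed.

(** Dominated convergence speaks of sequences, so the continuity of a convolution is tested along
    them; the next lemma does the same for limits at infinity. *)
Lemma cvgC_seq_nbhs (f : R -> C) (p : R) (l : C) :
  (forall u : nat -> R, u n @[n --> \oo] --> p -> f (u n) @[n --> \oo] --> l) ->
  f x @[x --> p] --> l.
Proof.
move=> H; apply/cvgC_P; split; apply/(@cvg_nbhsP _ R^o) => u /H /cvgC_P;
  by case.
Qed.

Lemma cvgC_seq_pinfty (f : R -> C) (l : C) :
  (forall u : nat -> R, u n @[n --> \oo] --> +oo ->
     f (u n) @[n --> \oo] --> l) ->
  f x @[x --> +oo] --> l.
Proof.
move=> H; apply/cvgC_P; split; apply/cvg_pinftyP => u /H /cvgC_P;
  by case.
Qed.

(** This difference quotient is the form in which differentiation under the integral sign gives its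
    result, and in it a translation of the argument is a mere rewriting. *)
Lemma is_derive1P (V : normedModType R) (f : R -> V) (x : R) (df : V) :
  is_derive x 1 f df <-> h^-1 *: (f (h + x) - f x) @[h --> 0^'] --> df.
Proof.
have E : (fun h : R => h^-1 *: (f (h + x) - f x)) =
         (fun h : R => h^-1 *: ((f \o shift x) (h *: 1) - f x)).
  by apply/funext => h /=; rewrite [h *: 1]mulr1.
rewrite E; split => [[dfx <-]|H]; first exact: dfx.
apply: DeriveDef; first by apply/cvg_ex; exists df.
exact: cvg_lim.
Qed.

Lemma is_derive_continuous (V : normedModType R) (f df : R -> V) :
  (forall x : R, is_derive x 1 f (df x)) -> continuous f.
Proof.
move=> H x; have [? _] := H x.
by apply: differentiable_continuous; apply/derivable1_diffP.
Qed.

Lemma is_deriveCP (f : R -> C) (x : R) (df : C) :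
  is_derive x 1 f df <->
  is_derive x 1 (fun y => Re (f y)) (Re df) /\
  is_derive x 1 (fun y => Im (f y)) (Im df).
Proof.
rewrite !is_derive1P cvgC_P.
have ER : (fun h : R => Re (h^-1 *: (f (h + x) - f x))) =
   (fun h => h^-1 *: (Re (f (h + x)) - Re (f x))).
  by apply/funext => h; rewrite cReZ cReB.
have EI : (fun h : R => Im (h^-1 *: (f (h + x) - f x))) =
   (fun h => h^-1 *: (Im (f (h + x)) - Im (f x))).
  by apply/funext => h; rewrite cImZ cImB.
by rewrite ER EI.
Qed.

Lemma is_deriveCM (f g : R -> C) (x : R) (df dg : C) :
  is_derive x 1 f df -> is_derive x 1 g dg ->
  is_derive x 1 (fun y => f y * g y) (df * g x + f x * dg).
Proof.
move=> /is_deriveCP[f1 f2] /is_deriveCP[g1 g2]; apply/is_deriveCP; split.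
- under eq_fun do rewrite cReM.
  apply: is_derive_eq; rewrite /= cReD !cReM /GRing.scale/=; ring.
- under eq_fun do rewrite cImM.
  apply: is_derive_eq; rewrite /= cImD !cImM /GRing.scale/=; ring.
Qed.

End ComplexLimits.

(** * Iterated derivatives of sums, products and translates *)

Section SmoothFunctions.
Variable R : realType.
Local Notation C := (Rcomplex R).
Implicit Types (f g : R -> C) (F G : nat -> R -> C) (S : set (R -> C)).

Lemma smooth_is_derive f : smooth f ->
  forall j (x : R), is_derive x 1 (derive1n j f) (derive1n (j.+1) f x).
Proof.
by move=> sf j x; apply: DeriveDef; rewrite ?sf// derive1nS derive1E.
Qed.

(** A sequence that starts at [f] and in which each term differentiates to the next can only be that
    of the iterated derivatives. Every formula for the derivatives of an operation is obtained by
    exhibiting such a sequence. *)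
Lemma smooth_tower f F : F 0%N = f ->
  (forall j (x : R), is_derive x 1 (F j) (F j.+1 x)) ->
  smooth f /\ forall j, derive1n j f = F j.
Proof.
move=> F0 dF.
have E j : derive1n j f = F j.
  elim: j => [|j IH]; first by rewrite derive1n0.
  by rewrite derive1nS IH; apply/funext => x; rewrite derive1E derive_val.
by split=> // j x; rewrite E; have [] := dF j x.
Qed.

Lemma smooth_continuous f : smooth f -> forall j, continuous (derive1n j f).
Proof. by move=> sf j; apply/is_derive_continuous/smooth_is_derive. Qed.

(* The terms of Leibniz's rule, not grouped by Pascal's rule. *)
Fixpoint leibniz n F G : R -> C :=
  if n is n'.+1 then
    fun x => leibniz n' (F \o succn) G x + leibniz n' F (G \o succn) x
  else fun x => F 0%N x * G 0%N x.

(** Both summands of [leibniz n.+1 F G] are Leibniz sums of order [n] with one sequence shifted. The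
    induction is therefore over all [F] and [G], and its base is the product rule. *)
Lemma is_derive_leibniz n F G :
  (forall j (x : R), is_derive x 1 (F j) (F j.+1 x)) ->
  (forall j (x : R), is_derive x 1 (G j) (G j.+1 x)) ->
  forall x : R, is_derive x 1 (leibniz n F G) (leibniz n.+1 F G x).
Proof.
elim: n F G => [|n IH] F G dF dG x; first exact: is_deriveCM.
exact: is_deriveD.
Qed.

Lemma smoothD f g : smooth f -> smooth g ->
  smooth (fun x => f x + g x) /\
  forall j, derive1n j (fun x => f x + g x) =
    (fun x => derive1n j f x + derive1n j g x).
Proof.
move=> sf sg.
apply: (@smooth_tower _ (fun j x => derive1n j f x + derive1n j g x)) => //.
by move=> j x; apply: is_deriveD; exact: smooth_is_derive.
Qed.

Lemma smoothM f g : smooth f -> smooth g ->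
  smooth (fun x => f x * g x) /\
  forall j, derive1n j (fun x => f x * g x) =
    leibniz j (fun i => derive1n i f) (fun i => derive1n i g).
Proof.
move=> sf sg.
apply: (@smooth_tower _
  (fun j => leibniz j (fun i => derive1n i f) (fun i => derive1n i g))).
  by [].
by move=> j x; apply: is_derive_leibniz; exact: smooth_is_derive.
Qed.

Lemma smooth_cst (c : C) : smooth (fun=> c) /\
  forall j, derive1n j ((fun=> c) : R -> C) = fun=> if j is 0%N then c else 0.
Proof.
exact: (@smooth_tower _ (fun j (x : R) => if j is 0%N then c else 0)).
Qed.

Lemma smoothB f g : smooth f -> smooth g ->
  smooth (fun x => f x - g x) /\
  forall j, derive1n j (fun x => f x - g x) =
    (fun x => derive1n j f x - derive1n j g x).
Proof.
move=> sf sg.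
apply: (@smooth_tower _ (fun j x => derive1n j f x - derive1n j g x)) => //.
by move=> j x; apply: is_deriveB; exact: smooth_is_derive.
Qed.

Lemma smooth_translate t f : smooth f ->
  smooth (translate t f) /\
  forall j, derive1n j (translate t f) = translate t (derive1n j f).
Proof.
move=> sf; apply: (@smooth_tower _ (fun j => translate t (derive1n j f))) => //.
move=> j x; have := smooth_is_derive sf j (x + t); rewrite !is_derive1P.
by rewrite /translate; under [in X in X -> _]eq_fun do rewrite addrA.
Qed.

Lemma smooth_derive1n k f : smooth f ->
  smooth (derive1n k f) /\
  forall j, derive1n j (derive1n k f) = derive1n (k + j) f.
Proof.
move=> sf.
apply: (@smooth_tower _ (fun j => derive1n (k + j) f)); rewrite ?addn0//.
by move=> j x; rewrite addnS; exact: smooth_is_derive.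
Qed.

(** The common shape of the test spaces: [Baa] and [Baaa] are instances by conversion, and [B]
    becomes one in [B_Cb]. Closure properties are proved once, for a general [S]. *)
Definition smooth_in S : set (R -> C) :=
  [set f | smooth f /\ forall j, S (derive1n j f)].

Lemma smooth_in_mono S S' : S `<=` S' -> smooth_in S `<=` smooth_in S'.
Proof. by move=> SS' f [sf Sf]; split => // j; exact: SS'. Qed.

Lemma smooth_inD S f g :
  (forall a b, S a -> S b -> S (fun x => a x + b x)) ->
  smooth_in S f -> smooth_in S g -> smooth_in S (fun x => f x + g x).
Proof.
move=> SD [sf Sf] [sg Sg]; have [s E] := smoothD sf sg.
by split=> // j; rewrite E; exact: SD.
Qed.

Lemma smooth_inM S f g :
  (forall a b, S a -> S b -> S (fun x => a x + b x)) ->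
  (forall a b, S a -> S b -> S (fun x => a x * b x)) ->
  smooth_in S f -> smooth_in S g -> smooth_in S (fun x => f x * g x).
Proof.
move=> SD SM [sf Sf] [sg Sg]; have [s E] := smoothM sf sg.
split=> // j; rewrite E.
(* Generalised to arbitrary sequences in [S], since the recursion shifts them. *)
suff H F G : (forall i, S (F i)) -> (forall i, S (G i)) -> S (leibniz j F G).
  exact: H.
elim: j F G => [|j IH] F G SF SG /=; first exact: SM.
by apply: SD; apply: IH => // i; [exact: SF|exact: SG].
Qed.

Lemma smooth_in_translate S t f : (forall a, S a -> S (translate t a)) ->
  smooth_in S f -> smooth_in S (translate t f).
Proof.
move=> St [sf Sf]; have [s E] := smooth_translate t sf.
by split=> // j; rewrite E; exact: St.
Qed.

Lemma smooth_in_derive1n S k f : smooth_in S f -> smooth_in S (derive1n k f).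
Proof.
move=> [sf Sf]; have [s E] := smooth_derive1n k sf.
by split=> // j; rewrite E.
Qed.

Lemma smooth_in_cst S (c : C) : (forall a : C, S (fun=> a)) ->
  smooth_in S (fun=> c).
Proof. by move=> Sc; have [s E] := smooth_cst c; split=> // j; rewrite E. Qed.

End SmoothFunctions.

(** * The algebras of almost automorphic and asymptotically almost automorphic functions *)

Section AlmostAutomorphic.
Variable R : realType.
Local Notation C := (Rcomplex R).
Implicit Types (f g h : R -> C).

Lemma bounded_funCP f :
  bounded_fun f <-> exists M : R, forall x, `|f x| <= M.
Proof.
split=> [[M [_ fM]]|[M fM]].
  by exists (M + 1) => x; apply: fM; rewrite ?ltrDl.
exists M; split; first exact: num_real.
by move=> N MN x _; exact: le_trans (fM x) (ltW MN).
Qed.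

Lemma CbD f g : Cb f -> Cb g -> Cb (fun x => f x + g x).
Proof.
move=> [cf /bounded_funCP[M fM]] [cg /bounded_funCP[N gN]]; split.
  by move=> x; exact: cvgD (cf x) (cg x).
apply/bounded_funCP; exists (M + N) => x.
by rewrite (le_trans (ler_normD _ _))// lerD.
Qed.

Lemma CbM f g : Cb f -> Cb g -> Cb (fun x => f x * g x).
Proof.
move=> [cf /bounded_funCP[M fM]] [cg /bounded_funCP[N gN]]; split.
  by move=> x; exact: cvgCM (cf x) (cg x).
by apply/bounded_funCP; exists (M * N) => x; rewrite normRcomplexM ler_pM.
Qed.

Lemma Cb_cst (c : C) : Cb (fun=> c : C).
Proof.
split; first by move=> x; exact: cvg_cst.
by apply/bounded_funCP; exists `|c|.
Qed.

Lemma Cb_translate t f : Cb f -> Cb (translate t f).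
Proof.
move=> [cf /bounded_funCP[M fM]]; split.
  move=> x; apply: continuous_comp; last exact: cf.
  by apply: cvgD; [exact: cvg_id|exact: cvg_cst].
by apply/bounded_funCP; exists M => x; exact: fM.
Qed.

Lemma Caa_cst (c : C) : Caa (fun=> c : C).
Proof.
split; first by move=> x; exact: cvg_cst.
by move=> s; exists id, (fun=> c); split => // x; exact: cvg_cst.
Qed.

Lemma increasing_seq_ge (k : nat -> nat) : increasing_seq k ->
  forall n, (n <= k n)%N.
Proof.
move=> ik; elim=> // n IH; rewrite (leq_ltn_trans IH)// ltnNge.
by have := ik n.+1 n; rewrite leEnat => ->; rewrite ltnn.
Qed.

Lemma cvg_increasing_seq (T : topologicalType) (u : nat -> T) (l : T)
    (k : nat -> nat) :
  increasing_seq k -> u n @[n --> \oo] --> l -> u (k n) @[n --> \oo] --> l.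
Proof.
move=> ik; apply: cvg_comp => A [N _ NA]; exists N => // n Nn.
exact/NA/(leq_trans Nn)/increasing_seq_ge.
Qed.

(** Otherwise there are points [s n] with [|g (s n)| > n]. Along a subsequence the values of [g] at
    these points converge to [g' 0], so they are eventually below [|g' 0| + 1], while the [n]-th of
    them exceeds [k n >= n]. *)
Lemma Caa_bounded g : Caa g -> exists M : R, forall x, `|g x| <= M.
Proof.
move=> [_ aag]; apply: contrapT => /forallNP gM.
have /choice[s gs] : forall n : nat, exists x, n%:R < `|g x|.
  move=> n; have /existsNP[x gx] := gM n%:R.
  by exists x; rewrite ltNge; exact/negP.
have [k [g' [ik gg' _]]] := aag s.
have [N _ small] : \forall n \near \oo, `|g (0 + s (k n))| < `|g' 0| + 1.
  by apply: cvgr_norm_lt (gg' 0) _ _; rewrite ltrDl.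
have [n nN] : exists n, (N <= n)%N /\ `|g' 0| + 1 <= n%:R.
  exists (maxn N (Num.truncn (`|g' 0| + 1)).+1); split; first exact: leq_maxl.
  rewrite (le_trans (ltW (truncnS_gt _)))// ler_nat.
  exact: leq_maxr.
have := small n nN.1; rewrite /= add0r ltNge => /negP; apply.
rewrite (le_trans nN.2)// (le_trans _ (ltW (gs _)))// ler_nat.
exact: increasing_seq_ge.
Qed.

Lemma Caa_Cb : @Caa R `<=` @Cb R.
Proof. by move=> g [cg aag]; split => //; exact/bounded_funCP/Caa_bounded. Qed.

(** The subsequence for [g] is extracted from the one for [f]; the limits already obtained for [f]
    survive this refinement. Any continuous operation can then be applied to the limits, in both
    directions. *)
Lemma Caa_op (op : C -> C -> C) f g :
  (forall T (F : set_system T), Filter F -> forall (a b : T -> C) (l m : C),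
     a x @[x --> F] --> l -> b x @[x --> F] --> m ->
     op (a x) (b x) @[x --> F] --> op l m) ->
  Caa f -> Caa g -> Caa (fun x => op (f x) (g x)).
Proof.
move=> cvgop [cf aaf] [cg aag]; split.
  by move=> x; exact: cvgop (cf x) (cg x).
move=> s; have [k1 [f' [ik1 ff' f'f]]] := aaf s.
have [k2 [g' [ik2 gg' g'g]]] := aag (s \o k1).
exists (k1 \o k2), (fun x => op (f' x) (g' x)); split.
- by move=> n m; rewrite /= -ik2; exact: ik1.
- by move=> x; apply: cvgop (gg' x); exact: (cvg_increasing_seq ik2 (ff' x)).
- by move=> x; apply: cvgop (g'g x); exact: (cvg_increasing_seq ik2 (f'f x)).
Qed.

Lemma CaaD f g : Caa f -> Caa g -> Caa (fun x => f x + g x).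
Proof. by apply: Caa_op => T F FF a b l m; exact: cvgD. Qed.

Lemma CaaM f g : Caa f -> Caa g -> Caa (fun x => f x * g x).
Proof. by apply: Caa_op => T F FF a b l m; exact: cvgCM. Qed.

Lemma Caa_translate t f : Caa f -> Caa (translate t f).
Proof.
move=> aaf; have [ct _] := Cb_translate t (Caa_Cb aaf); split=> // s.
have [k [f' [ik ff' f'f]]] := aaf.2 s.
exists k, (translate t f'); split => // x; rewrite /translate.
  by under eq_fun do rewrite addrAC; exact: ff'.
by under eq_fun do rewrite addrAC; exact: f'f.
Qed.

Lemma Cplus0D f g : Cplus0 f -> Cplus0 g -> Cplus0 (fun x => f x + g x).
Proof.
move=> [bf f0] [bg g0]; split; first exact: CbD.
by rewrite -[X in _ --> X](addr0 0); exact: cvgD f0 g0.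
Qed.

Lemma Cplus0M f g : Cb f -> Cplus0 g -> Cplus0 (fun x => f x * g x).
Proof.
move=> bf [bg g0]; split; first exact: CbM.
have [_ /bounded_funCP[M fM]] := bf.
have M0 : 0 <= M by apply: le_trans (fM 0).
apply/cvgr0Pnorm_le => e e0.
(* The denominator is [M + 1] because [M] may be zero. *)
have eM : 0 < e / (M + 1) by rewrite divr_gt0// ltr_wpDl.
have /cvgr0Pnorm_le/(_ _ eM) := g0; apply: filterS => x gx.
rewrite normRcomplexM (le_trans (ler_pM _ _ (fM x) gx))//.
rewrite mulrCA; apply: ler_piMr; first exact: ltW.
by rewrite ler_pdivrMr ?ltr_wpDl// mul1r lerDl.
Qed.

Lemma Cplus0_translate t f : Cplus0 f -> Cplus0 (translate t f).
Proof.
move=> [bf f0]; split; first exact: Cb_translate.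
by rewrite /translate cvg_shiftr.
Qed.

(** The definition prescribes the decomposition on the half-line only. Setting [h := f - g] extends
    it to all of [R]: this is bounded since [g] is, and it has the old limit since it agrees with
    the old [h] for [x >= 0]. *)
Lemma CaaaP f : Caaa f <->
  exists g h, [/\ Caa g, Cplus0 h & f = (fun x => g x + h x)].
Proof.
split=> [[bf [g [h [aag h0 fE]]]]|[g [h [aag h0 ->]]]]; last first.
  by split; [apply: CbD h0.1; exact: Caa_Cb|exists g, h].
exists g, (fun x => -1 * g x + f x); split => //; last first.
  by apply/funext => x; rewrite mulN1r addNKr.
split; first by apply: CbD bf; apply: CbM; [exact: Cb_cst|exact: Caa_Cb].
apply: cvg_trans h0.2; apply: near_eq_cvg; near=> x.
by rewrite fE ?mulN1r ?addKr.
Unshelve. all: by end_near. Qed.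

Lemma Caa_Caaa : @Caa R `<=` @Caaa R.
Proof.
move=> g aag; apply/CaaaP; exists g, (fun=> 0); split => //.
  by split; [exact: Cb_cst|exact: cvg_cst].
by apply/funext => x; rewrite addr0.
Qed.

Lemma Caaa_Cb : @Caaa R `<=` @Cb R.
Proof. by move=> f []. Qed.

Lemma CaaaD f g : Caaa f -> Caaa g -> Caaa (fun x => f x + g x).
Proof.
move=> /CaaaP[f1 [f2 [aaf f0 ->]]] /CaaaP[g1 [g2 [aag g0 ->]]]; apply/CaaaP.
exists (fun x => f1 x + g1 x), (fun x => f2 x + g2 x); split.
- exact: CaaD.
- exact: Cplus0D.
- by apply/funext => x; rewrite addrACA.
Qed.

(** In the product of [f1 + f2] and [g1 + g2], everything but [f1 * g1] is [g1 * f2 + f * g2], where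
    a bounded factor meets one that vanishes at infinity. *)
Lemma CaaaM f g : Caaa f -> Caaa g -> Caaa (fun x => f x * g x).
Proof.
move=> aaaf /CaaaP[g1 [g2 [aag g0 ->]]].
have /CaaaP[f1 [f2 [aaf f0 fE]]] := aaaf; apply/CaaaP.
exists (fun x => f1 x * g1 x), (fun x => g1 x * f2 x + f x * g2 x); split.
- exact: CaaM.
- apply: Cplus0D; first by apply: Cplus0M => //; exact: Caa_Cb.
  by apply: Cplus0M => //; exact: Caaa_Cb.
- by apply/funext => x; rewrite mulrDr {1}fE mulrDl (mulrC (g1 x)) !addrA.
Qed.

Lemma Caaa_translate t f : Caaa f -> Caaa (translate t f).
Proof.
move=> /CaaaP[g [h [aag h0 ->]]]; apply/CaaaP.
exists (translate t g), (translate t h); split => //.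
  exact: Caa_translate.
exact: Cplus0_translate.
Qed.

End AlmostAutomorphic.

(** * The essential supremum of a continuous function *)

Section EssentialSupremum.
Variable R : realType.
Local Notation C := (Rcomplex R).
Implicit Types (f g : R -> C).

(** If [f x > M], then [f > M] on a whole ball around [x], whose positive measure cannot fit into a
    null set. *)
Lemma continuous_ae_le (f : R -> R) (M : R) : continuous f ->
  {ae @lebesgue_measure R, forall x, f x <= M} -> forall x, f x <= M.
Proof.
move=> cf [N [mN N0 fN]] x; rewrite leNgt; apply/negP => Mx.
have [d /= d0 xd] : \forall y \near x, M < f y by exact: cvgr_gt (cf x) _ Mx.
have : (lebesgue_measure (ball x d) <= lebesgue_measure N)%E.
  apply: le_measure; rewrite ?inE//; first exact: measurable_ball.
  by move=> y /xd My; apply: fN => /=; apply/negP; rewrite -ltNge.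
rewrite N0 lebesgue_measure_ball; last exact: ltW.
by rewrite lee_fin leNgt pmulrn_lgt0 ?d0.
Qed.

Lemma LpNorm_le f (M : R) : continuous f ->
  (LpNorm +oo f <= M%:E)%E <-> forall x, `|f x| <= M.
Proof.
(* [Lnorm] at [+oo] is the essential supremum only under the condition that the whole space has
   positive measure. *)
have mu0 : (0 < @lebesgue_measure R setT)%E.
  by rewrite -set_itvNyy lebesgue_measure_itv/= ltry.
move=> cf; rewrite /LpNorm unlock mu0.
have cnf : continuous (fun x => `|f x|) by move=> x; exact: cvg_norm (cf x).
split=> [/ess_supP fM|fM].
  apply: continuous_ae_le => //; apply: filterS fM => x /=.
  by rewrite normr_id lee_fin.
by apply/ess_supP/nearW => x /=; rewrite normr_id lee_fin.
Qed.

Lemma LpNorm_ge0 p f : (0 <= LpNorm p f)%E.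
Proof. exact: Lnorm_ge0. Qed.

Lemma LpNorm_fin f : continuous f ->
  (LpNorm +oo f < +oo)%E <-> exists M : R, forall x, `|f x| <= M.
Proof.
move=> cf; split=> [foo|[M /LpNorm_le fM]].
  exists (fine (LpNorm +oo f)); apply/LpNorm_le => //.
  by rewrite fineK// ge0_fin_numE// LpNorm_ge0.
by rewrite (le_lt_trans (fM _))// ltry.
Qed.

Lemma B_Cb : @B R = smooth_in (@Cb R).
Proof.
apply/seteqP; split => f [sf Bf]; split => // j;
  have cf : continuous (derive1n j f) by exact: smooth_continuous.
  by split => //; apply/bounded_funCP/LpNorm_fin.
by apply/LpNorm_fin => //; apply/bounded_funCP; have [] := Bf j.
Qed.

Lemma Baaa_B : @Baaa R `<=` @B R.
Proof. rewrite B_Cb; exact/smooth_in_mono/Caaa_Cb. Qed.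

Lemma Baa_Baaa : @Baa R `<=` @Baaa R.
Proof. exact/smooth_in_mono/Caa_Caaa. Qed.

End EssentialSupremum.

(** * Growth of nets as uniform estimates *)

Section Nets.
Variable R : realType.
Local Notation C := (Rcomplex R).
Implicit Types (a b : net R) (m n : int) (X : set (R -> C)).

Lemma Ieps_gt0 (e : Ieps R) : 0 < val e.
Proof. by have := valP e; rewrite inE/= in_itv/= => /andP[]. Qed.

Lemma Ieps_le1 (e : Ieps R) : val e <= 1.
Proof. by have := valP e; rewrite inE/= in_itv/= => /andP[]. Qed.

(** For continuous functions this is [bigO_eps] of the supremum norm, with real bounds at each point
    in place of extended real ones. *)
Definition unif_O a m : Prop := exists K d : R, 0 < d /\
  forall e, val e < d -> forall x, `|a e x| <= K * val e ^ m.

Lemma expIeps_le (e : Ieps R) m n : m <= n -> val e ^ n <= val e ^ m.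
Proof.
move: (val e) (Ieps_gt0 e) (Ieps_le1 e) => x x0 x1 mn.
rewrite -(subrK m n) expfzDr ?gt_eqF// ler_piMl ?exprz_ge0 ?(ltW x0)//.
rewrite -(expr0z x); apply: ler_wpiXz2l => //; rewrite ?inE ?subr_ge0//.
- exact: ltW.
- by rewrite -topredE/= subr_ge0.
Qed.

Lemma unif_O_le a m n : n <= m -> unif_O a m -> unif_O a n.
Proof.
(* [K] carries no sign condition, so [|K|] is taken before the power of [val e <= 1] is enlarged. *)
move=> nm [K [d [d0 aK]]]; exists `|K|, d; split => // e ed x.
rewrite (le_trans (aK e ed x))//.
have e0 := Ieps_gt0 e.
rewrite (@le_trans _ _ (`|K| * val e ^ m))//.
  by rewrite ler_wpM2r ?ler_norm// exprz_ge0// ltW.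
by rewrite ler_wpM2l// expIeps_le.
Qed.

Lemma unif_OD a b m : unif_O a m -> unif_O b m ->
  unif_O (fun e x => a e x + b e x) m.
Proof.
move=> [K [d [d0 aK]]] [L [r [r0 bL]]].
exists (K + L), (Num.min d r); rewrite lt_min d0 r0; split => // e.
rewrite lt_min => /andP[ed er] x.
by rewrite (le_trans (ler_normD _ _))// mulrDl lerD ?aK ?bL.
Qed.

Lemma unif_OM a b m n : unif_O a m -> unif_O b n ->
  unif_O (fun e x => a e x * b e x) (m + n).
Proof.
move=> [K [d [d0 aK]]] [L [r [r0 bL]]].
exists (K * L), (Num.min d r); rewrite lt_min d0 r0; split => // e.
rewrite lt_min => /andP[ed er] x.
rewrite normRcomplexM expfzDr ?gt_eqF ?Ieps_gt0// mulrACA.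
by rewrite ler_pM ?aK ?bL.
Qed.

Definition mod_O a := exists m : nat, unif_O a (- m%:Z).
Definition neg_O a := forall m : nat, unif_O a m%:Z.

Lemma neg_mod_O a : neg_O a -> mod_O a.
Proof. by move=> /(_ 0%N) na; exists 0%N. Qed.

Lemma mod_OD a b : mod_O a -> mod_O b -> mod_O (fun e x => a e x + b e x).
Proof.
(* The exponent [m + n] serves both summands, in place of the maximum. *)
move=> [m am] [n bn]; exists (m + n)%N; apply: unif_OD.
  by apply: unif_O_le am; lia.
by apply: unif_O_le bn; lia.
Qed.

Lemma mod_OM a b : mod_O a -> mod_O b -> mod_O (fun e x => a e x * b e x).
Proof.
move=> [m am] [n bn]; exists (m + n)%N.
by rewrite PoszD opprD; exact: unif_OM.
Qed.

Lemma neg_OD a b : neg_O a -> neg_O b -> neg_O (fun e x => a e x + b e x).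
Proof. by move=> na nb m; exact: unif_OD. Qed.

(** To reach order [m], the negligible factor is taken at order [m + n], which absorbs the growth of
    order [n] of the moderate one. *)
Lemma neg_OM a b : neg_O a -> mod_O b -> neg_O (fun e x => a e x * b e x).
Proof.
move=> na [n bn] m; have := unif_OM (na (m + n)%N) bn.
by rewrite PoszD addrK.
Qed.

Lemma mod_O_cst (c : C) : mod_O (fun _ _ => c).
Proof.
by exists 0%N, `|c|, 1; split => // e _ x; rewrite oppr0 expr0z mulr1.
Qed.

Lemma bigO_epsD (f g : Ieps R -> \bar R) m :
  bigO_eps f m -> bigO_eps g m -> bigO_eps (fun e => f e + g e)%E m.
Proof.
move=> [K [d [d0 aK]]] [L [r [r0 bL]]].
exists (K + L), (Num.min d r); rewrite lt_min d0 r0; split => // e.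
rewrite lt_min => /andP[ed er].
by rewrite mulrDl EFinD leeD ?aK ?bL.
Qed.

Lemma bigO_eps_le (f : Ieps R -> \bar R) m n : n <= m ->
  bigO_eps f m -> bigO_eps f n.
Proof.
move=> nm [K [d [d0 aK]]]; exists `|K|, d; split => // e ed.
rewrite (le_trans (aK e ed))// lee_fin.
have e0 := Ieps_gt0 e.
rewrite (@le_trans _ _ (`|K| * val e ^ m))//.
  by rewrite ler_wpM2r ?ler_norm// exprz_ge0// ltW.
by rewrite ler_wpM2l// expIeps_le.
Qed.

Lemma bigO_eps_LpNorm a m : (forall e, continuous (a e)) ->
  bigO_eps (fun e => LpNorm +oo (a e)) m <-> unif_O a m.
Proof.
move=> ca; split=> -[K [d [d0 aK]]]; exists K, d; split => // e ed.
  by apply/LpNorm_le => //; exact: aK.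
by apply/LpNorm_le => //; exact: aK.
Qed.

Lemma LpNorm_le_DLp_norm p j k (f : R -> C) : (j <= k)%N ->
  (LpNorm p (derive1n j f) <= DLp_norm p k f)%E.
Proof.
move=> jk; rewrite /DLp_norm big_mkord.
rewrite (bigD1 (Ordinal (jk : j < k.+1)%N))//= leeDl//.
by apply: sume_ge0 => i _; exact: LpNorm_ge0.
Qed.

Lemma DLp_normS p k (f : R -> C) :
  DLp_norm p k.+1 f = (DLp_norm p k f + LpNorm p (derive1n k.+1 f))%E.
Proof. by rewrite /DLp_norm big_nat_recr. Qed.

Lemma DLp_norm0 p (f : R -> C) : DLp_norm p 0 f = LpNorm p f.
Proof. by rewrite /DLp_norm big_nat1. Qed.

Lemma le_bigO_eps (f g : Ieps R -> \bar R) m : (forall e, f e <= g e)%E ->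
  bigO_eps g m -> bigO_eps f m.
Proof.
move=> fg [K [d [d0 gK]]]; exists K, d; split=> // e ed.
exact: le_trans (fg e) (gK e ed).
Qed.

(** A single derivative is dominated by the cumulative norm of its order. Conversely the norm of
    order [k] is a finite sum, and the exponents of its terms are added up by induction. Continuity
    turns each norm into a supremum. *)
Lemma moderate_ooP X (u : net R) : X `<=` @B R -> (forall e, X (u e)) ->
  moderate +oo X u <-> forall j, mod_O (fun e => derive1n j (u e)).
Proof.
move=> XB Xu.
have cu j e : continuous (derive1n j (u e)).
  by apply: smooth_continuous; have [] := XB _ (Xu e).
split=> [[_ mu] j|mu].
  have [m um] := mu j; exists m; apply/bigO_eps_LpNorm => //.
  by apply: le_bigO_eps um => e; exact: LpNorm_le_DLp_norm.
split=> //; elim=> [|k [m IH]].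
  have [m um] := mu 0%N; exists m.
  under [X in bigO_eps X]eq_fun do rewrite DLp_norm0.
  by apply/bigO_eps_LpNorm => //; exact: cu 0%N.
have [n un] := mu k.+1; exists (m + n)%N.
under [X in bigO_eps X]eq_fun do rewrite DLp_normS.
apply: bigO_epsD; first by apply: bigO_eps_le IH; lia.
by apply/bigO_eps_LpNorm => //; apply: unif_O_le un; lia.
Qed.

Lemma negligible_ooP X (u : net R) : X `<=` @B R -> (forall e, X (u e)) ->
  negligible_net +oo X u <-> forall j, neg_O (fun e => derive1n j (u e)).
Proof.
move=> XB Xu.
have cu j e : continuous (derive1n j (u e)).
  by apply: smooth_continuous; have [] := XB _ (Xu e).
split=> [[_ mu] j m|mu].
  apply/bigO_eps_LpNorm => //.
  by apply: le_bigO_eps (mu j m) => e; exact: LpNorm_le_DLp_norm.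
split=> // k m; elim: k => [|k IH].
  under [X in bigO_eps X]eq_fun do rewrite DLp_norm0.
  by apply/bigO_eps_LpNorm => //; [exact: cu 0%N|exact: mu 0%N m].
under [X in bigO_eps X]eq_fun do rewrite DLp_normS.
by apply: bigO_epsD => //; apply/bigO_eps_LpNorm => //; exact: mu.
Qed.

End Nets.

(** * Convolution of bounded functions with integrable ones *)

Section Convolution.
Variable R : realType.
Local Notation C := (Rcomplex R).
Local Notation mu := (@lebesgue_measure R).
Implicit Types (F G f g h : R -> C).

Definition measurableC F :=
  measurable_fun setT (fun y => Re (F y)) /\
  measurable_fun setT (fun y => Im (F y)).

Lemma continuous_measurableC F : continuous F -> measurableC F.
Proof.
move=> cF; split; apply: continuous_measurable_fun => x;
  by have /cvgC_P[] := cF x.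
Qed.

Lemma measurableCM F G : measurableC F -> measurableC G ->
  measurableC (fun y => F y * G y).
Proof.
move=> [F1 F2] [G1 G2]; split.
  under eq_fun do rewrite cReM.
  by apply: measurable_funB; exact: measurable_funM.
under eq_fun do rewrite cImM.
by apply: measurable_funD; exact: measurable_funM.
Qed.

Lemma measurableC_cvg (F_ : nat -> R -> C) F : (forall n, measurableC (F_ n)) ->
  (forall y, F_ n y @[n --> \oo] --> F y) -> measurableC F.
Proof.
move=> mF FF; split.
  apply: (@measurable_fun_cvg _ _ _ _ (fun n y => Re (F_ n y))) => [n|y _].
    by have [] := mF n.
  by have /cvgC_P[] := FF y.
apply: (@measurable_fun_cvg _ _ _ _ (fun n y => Im (F_ n y))) => [n|y _].
  by have [] := mF n.
by have /cvgC_P[] := FF y.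
Qed.

Lemma measurableC_reflect F (x : R) : measurableC F ->
  measurableC (fun y => F (x - y)).
Proof.
have mx : measurable_fun setT (fun y : R => x - y).
  by apply: measurable_funB => //; exact: measurable_cst.
by move=> [F1 F2]; split; [exact: (measurableT_comp F1 mx)|
  exact: (measurableT_comp F2 mx)].
Qed.

Lemma Rintegral_dominated_cvg (F_ : nat -> R -> R) (F G : R -> R) :
  (forall n, measurable_fun setT (F_ n)) ->
  (forall y, F_ n y @[n --> \oo] --> F y) ->
  (forall n y, `|F_ n y| <= G y) -> mu.-integrable setT (EFin \o G) ->
  (\int[mu]_y F_ n y)%R @[n --> \oo] --> (\int[mu]_y F y)%R.
Proof.
move=> mF FF FG iG.
have mF' : measurable_fun setT F.
  by apply: (measurable_fun_cvg mF) => y _; exact: FF.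
have FFE y : (EFin \o F_ n) y @[n --> \oo] --> (EFin \o F) y.
  by apply: cvg_EFin; [exact: nearW|exact: FF].
have [|||||iF _ cF] := @dominated_convergence _ _ _ mu _ measurableT
  (fun n => EFin \o F_ n) (EFin \o F) (EFin \o G).
- by move=> n; apply/measurable_EFinP; exact: mF.
- by apply/measurable_EFinP; exact: mF'.
- by apply: aeW => y _; exact: FFE.
- by [].
- by apply: aeW => y n _; rewrite lee_fin.
apply: fine_cvg; rewrite fineK//.
exact: integrable_fin_num.
Qed.

(** The complex integral: [convolution f g x] is by conversion [cint] of the function
    [f (x - y) * g y] of [y]. *)
Definition cint F : C := Complex (\int[mu]_y Re (F y)) (\int[mu]_y Im (F y)).

Definition L1C g := measurableC g /\ mu.-integrable setT (fun y => (`|g y|)%:E).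

Lemma integrable_bounded F g (M : R) : measurableC F ->
  (forall y, `|F y| <= M) -> L1C g ->
  mu.-integrable setT (EFin \o (fun y => Re (F y * g y))) /\
  mu.-integrable setT (EFin \o (fun y => Im (F y * g y))).
Proof.
move=> mF FM [mg ig]; have [m1 m2] := measurableCM mF mg.
have iMg : mu.-integrable setT (fun y => (M%:E * (`|g y|)%:E)%E).
  exact: integrableZl.
split; apply: (le_integrable measurableT _ _ iMg).
- exact/measurable_EFinP.
- move=> y _; rewrite /= lee_fin (le_trans (normC_Re _))// normRcomplexM.
  by rewrite normrM normr_id ler_wpM2r// (le_trans (FM y)) ?ler_norm.
- exact/measurable_EFinP.
- move=> y _; rewrite /= lee_fin (le_trans (normC_Im _))// normRcomplexM.
  by rewrite normrM normr_id ler_wpM2r// (le_trans (FM y)) ?ler_norm.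
Qed.

(** Both parts of the integrand are dominated by [M * |g y|], so bounded pointwise convergence of
    the first factor is enough. *)
Lemma cint_dominated_cvg (F_ : nat -> R -> C) F g (M : R) :
  (forall n, measurableC (F_ n)) -> (forall n y, `|F_ n y| <= M) ->
  (forall y, F_ n y @[n --> \oo] --> F y) -> L1C g ->
  cint (fun y => F_ n y * g y) @[n --> \oo] --> cint (fun y => F y * g y).
Proof.
move=> mF FM FF [mg ig]; apply/cvgC_P.
have iMg : mu.-integrable setT (fun y => (M%:E * (`|g y|)%:E)%E).
  exact: integrableZl.
have cFg y : F_ n y * g y @[n --> \oo] --> F y * g y.
  by apply: cvgCM (FF y) _; exact: cvg_cst.
by split; apply: (@Rintegral_dominated_cvg _ _ (fun y => M * `|g y|)) => //
  [n|y|n y]; [by have [] := measurableCM (mF n) mg|by have /cvgC_P[] := cFg y|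
   rewrite (le_trans (normC_Re _) _)// normRcomplexM ler_wpM2r
  |by have [] := measurableCM (mF n) mg|by have /cvgC_P[] := cFg y|
   rewrite (le_trans (normC_Im _) _)// normRcomplexM ler_wpM2r].
Qed.

(** The real and the imaginary part contribute [M * N] each. The resulting factor 2 is harmless in
    estimates up to a constant. *)
Lemma cint_le F g (M N : R) : measurableC F -> (forall y, `|F y| <= M) ->
  L1C g -> (\int[mu]_y (`|g y|)%:E <= N%:E)%E ->
  `|cint (fun y => F y * g y)| <= M * N *+ 2.
Proof.
move=> mF FM L1g gN; have [mg ig] := L1g.
have [iR iI] := integrable_bounded mF FM L1g.
have iMg : mu.-integrable setT (EFin \o (fun y => M * `|g y|)).
  by rewrite (_ : EFin \o _ = (fun y => (M%:E * (`|g y|)%:E)%E))//;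
    exact: integrableZl.
have M0 : 0 <= M by rewrite (le_trans _ (FM 0)).
have gN' : \int[mu]_y (M * `|g y|) <= M * N.
  rewrite RintegralZl// ler_wpM2l// /Rintegral -lee_fin fineK//.
  exact: integrable_fin_num.
rewrite (le_trans (normC_le _))// mulr2n lerD//=.
- rewrite (le_trans (le_normr_Rintegral _ _))// (le_trans _ gN')//.
  apply: le_Rintegral => // [|y _]; first exact: integrable_norm.
  by rewrite (le_trans (normC_Re _))// normRcomplexM ler_wpM2r.
- rewrite (le_trans (le_normr_Rintegral _ _))// (le_trans _ gN')//.
  apply: le_Rintegral => // [|y _]; first exact: integrable_norm.
  by rewrite (le_trans (normC_Im _))// normRcomplexM ler_wpM2r.
Qed.

Lemma DLp1_L1C g : DLp 1 g -> L1C g.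
Proof.
move=> [sg /(_ 0%N)]; rewrite derive1n0 /LpNorm Lnorm1 => goo.
have cg : continuous g by exact: (@smooth_continuous _ _ sg 0%N).
split; first exact: continuous_measurableC.
apply/integrableP; split; last exact: goo.
apply/measurable_EFinP; apply: continuous_measurable_fun => x.
exact: cvg_norm (cg x).
Qed.

Lemma Cb_measurableC f : Cb f -> measurableC f.
Proof. by move=> [cf _]; exact: continuous_measurableC. Qed.

Lemma convolutionBl f1 f2 g : Cb f1 -> Cb f2 -> L1C g ->
  convolution (fun x => f1 x - f2 x) g =
  (fun x => convolution f1 g x - convolution f2 g x).
Proof.
move=> b1 b2 L1g; apply/funext => x.
have [M f1M] := (bounded_funCP _).1 b1.2.
have [N f2N] := (bounded_funCP _).1 b2.2.
have m1 := measurableC_reflect x (Cb_measurableC b1).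
have m2 := measurableC_reflect x (Cb_measurableC b2).
have [R1 I1] := integrable_bounded m1 (fun y => f1M (x - y)) L1g.
have [R2 I2] := integrable_bounded m2 (fun y => f2N (x - y)) L1g.
rewrite -[RHS]/(Complex _ _) /convolution -!RintegralB//.
congr Complex; apply: eq_Rintegral => y _.
  by rewrite mulrBl cReB.
by rewrite mulrBl cImB.
Qed.

Lemma convolutionDr f g1 g2 : Cb f -> L1C g1 -> L1C g2 ->
  convolution f (fun x => g1 x + g2 x) =
  (fun x => convolution f g1 x + convolution f g2 x).
Proof.
move=> bf L1 L2; apply/funext => x.
have [M fM] := (bounded_funCP _).1 bf.2.
have mf := measurableC_reflect x (Cb_measurableC bf).
have [R1 I1] := integrable_bounded mf (fun y => fM (x - y)) L1.
have [R2 I2] := integrable_bounded mf (fun y => fM (x - y)) L2.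
rewrite -[RHS]/(Complex _ _) /convolution -!RintegralD//.
congr Complex; apply: eq_Rintegral => y _.
  by rewrite mulrDr cReD.
by rewrite mulrDr cImD.
Qed.

Lemma convolution_le f g (M N : R) : Cb f -> (forall x, `|f x| <= M) ->
  L1C g -> (LpNorm 1 g <= N%:E)%E ->
  forall x, `|convolution f g x| <= M * N *+ 2.
Proof.
move=> bf fM L1g; rewrite /LpNorm Lnorm1 => gN x.
apply: (@cint_le (fun y => f (x - y))) => //.
  exact/measurableC_reflect/Cb_measurableC.
by under eq_integral do rewrite -[(`|_|)%:E]gee0_abs ?lee_fin//.
Qed.

Lemma L1C_LpNorm_fin g : L1C g -> (LpNorm 1 g < +oo)%E.
Proof. by move=> [_ /integrableP[_]]; rewrite /LpNorm Lnorm1. Qed.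

Lemma convolution_Cb f g : Cb f -> L1C g -> Cb (convolution f g).
Proof.
move=> bf L1g; have [M fM] := (bounded_funCP _).1 bf.2; split.
  move=> x; apply: cvgC_seq_nbhs => u ux.
  apply: (@cint_dominated_cvg (fun n y => f (u n - y)) _ _ M) => // n.
    exact/measurableC_reflect/Cb_measurableC.
  apply: continuous_cvg; first exact: bf.1.
  by apply: cvgB ux _; exact: cvg_cst.
apply/bounded_funCP; exists (M * fine (LpNorm 1 g) *+ 2).
apply: convolution_le => //; rewrite fineK// ge0_fin_numE ?LpNorm_ge0//.
exact: L1C_LpNorm_fin.
Qed.

(** Differentiation under the integral sign: the derivative in [z] of [f (z - y) * g y] is dominated
    by [N * |g y|], where [N] bounds [df]. *)
Lemma is_derive_convolution f df g (x : R) : Cb f -> Cb df ->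
  (forall x : R, is_derive x 1 f (df x)) -> L1C g ->
  is_derive x 1 (convolution f g) (convolution df g x).
Proof.
move=> bf bdf dF L1g.
have [M fM] := (bounded_funCP _).1 bf.2.
have [N dfN] := (bounded_funCP _).1 bdf.2.
have N0 : 0 <= N by rewrite (le_trans _ (dfN 0)).
have d1 (z y : R) : is_derive z 1 (fun z => f (z - y) * g y) (df (z - y) * g y).
  have : is_derive z 1 (fun z => f (z - y)) (df (z - y)).
    have := dF (z - y); rewrite !is_derive1P.
    by under [in X in X -> _]eq_fun do rewrite addrA.
  move/is_deriveCM => /(_ _ _ (is_derive_cst (g y) z 1)).
  by rewrite mulr0 addr0.
have iNg : mu.-integrable setT (EFin \o (fun y => N * `|g y|)).
  rewrite (_ : EFin \o _ = (fun y => (N%:E * (`|g y|)%:E)%E))//.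
  by apply: integrableZl; have [] := L1g.
(* The domination holds for every [z]; this interval is the neighbourhood of [x] on which the
   theorem is applied. *)
have xI : `]x - 1, x + 1[%classic x.
  by rewrite /= in_itv/= ltrDl ltrBlDr ltrDl ltr01.
have mf z := measurableC_reflect z (Cb_measurableC bf).
have int z := integrable_bounded (mf z) (fun y => fM (z - y)) L1g.
apply/is_deriveCP; split; apply/is_derive1P.
- have dR z y := proj1 ((is_deriveCP _ _ _).1 (d1 z y)).
  rewrite [X in _ --> X](_ : _ = \int[mu]_y
      partial1of2 (fun z y => Re (f (z - y) * g y)) x y)%R; last first.
    by apply: eq_Rintegral => y _; rewrite partial1of2E derive_val.
  apply: (cvg_differentiation_under_integral measurableT xI _ _ _ iNg) => //.
  + by move=> z _; have [] := int z.
  + by move=> y; rewrite mulr_ge0.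
  + move=> z y _ _; rewrite partial1of2E derive_val.
    by rewrite (le_trans (normC_Re _))// normRcomplexM ler_wpM2r.
- have dR z y := proj2 ((is_deriveCP _ _ _).1 (d1 z y)).
  rewrite [X in _ --> X](_ : _ = \int[mu]_y
      partial1of2 (fun z y => Im (f (z - y) * g y)) x y)%R; last first.
    by apply: eq_Rintegral => y _; rewrite partial1of2E derive_val.
  apply: (cvg_differentiation_under_integral measurableT xI _ _ _ iNg) => //.
  + by move=> z _; have [] := int z.
  + by move=> y; rewrite mulr_ge0.
  + move=> z y _ _; rewrite partial1of2E derive_val.
    by rewrite (le_trans (normC_Im _))// normRcomplexM ler_wpM2r.
Qed.

Lemma smooth_convolution f g : smooth_in (@Cb R) f -> L1C g ->
  smooth (convolution f g) /\
  forall j, derive1n j (convolution f g) = convolution (derive1n j f) g.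
Proof.
move=> [sf Bf] L1g.
apply: (@smooth_tower _ _ (fun j => convolution (derive1n j f) g)) => // j x.
by apply: is_derive_convolution => //; exact: smooth_is_derive.
Qed.

(** The subsequence that works for [f] works for the convolution, with limit function
    [convolution f' g]. Both limits follow by dominated convergence. *)
Lemma convolution_Caa f g : Caa f -> L1C g -> Caa (convolution f g).
Proof.
move=> aaf L1g; have [M fM] := Caa_bounded aaf.
have mf := Cb_measurableC (Caa_Cb aaf).
split; first by have [] := convolution_Cb (Caa_Cb aaf) L1g.
move=> s; have [k [f' [ik ff' f'f]]] := aaf.2 s.
exists k, (convolution f' g); split => // x.
  apply: (@cint_dominated_cvg (fun n y => f (x + s (k n) - y)) _ _ M) => //.
    by move=> n; exact: measurableC_reflect.
  by move=> y; under eq_fun do rewrite addrAC; exact: ff'.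
(* [f'] need not be continuous, but it is a pointwise limit of translates of [f]. *)
have mf' : measurableC f'.
  apply: (measurableC_cvg _ ff') => n.
  have [cf _] := Cb_translate (s (k n)) (Caa_Cb aaf).
  exact: continuous_measurableC cf.
apply: (@cint_dominated_cvg (fun n y => f' (x - s (k n) - y)) _ _ M) => //.
- by move=> n; exact: measurableC_reflect.
(* The bound [M] of [f] passes to the pointwise limit [f']. *)
- move=> n y; set z := _ - y.
  have cn : `|f (z + s (k n))| @[n --> \oo] --> `|f' z|.
    exact: cvg_norm (ff' z).
  rewrite -(cvg_lim _ cn)//; apply: limr_le; last exact: nearW.
  by apply/cvg_ex; exists `|f' z|.
- by move=> y; under eq_fun do rewrite addrAC; exact: f'f.
Qed.

Lemma convolution_Cplus0 f g : Cplus0 f -> L1C g -> Cplus0 (convolution f g).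
Proof.
move=> [bf f0] L1g; have [M fM] := (bounded_funCP _).1 bf.2.
split; first exact: convolution_Cb.
apply: cvgC_seq_pinfty => u uoo.
(* The limit 0 is written as an integral against [g], the form in which dominated convergence yields
   it. *)
have -> : 0 = cint (fun y => 0 * g y).
  by rewrite /cint /Rintegral !integral0_eq// => y _; rewrite mul0r.
apply: (@cint_dominated_cvg (fun n y => f (u n - y)) _ _ M) => //.
  by move=> n; exact/measurableC_reflect/Cb_measurableC.
move=> y; apply: cvg_comp f0.
exact: (cvg_comp _ _ uoo (cvg_addrr (- y))).
Qed.

Lemma convolution_Caaa f g : Caaa f -> L1C g -> Caaa (convolution f g).
Proof.
move=> /[dup] aaaf /CaaaP[f1 [f2 [aa1 [b2 f20] fE]]] L1g; apply/CaaaP.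
exists (convolution f1 g), (convolution f2 g); split.
- exact: convolution_Caa.
- exact: convolution_Cplus0.
(* Additivity in the first argument comes from the rule for differences, applied to
   [f1 = f - f2]. *)
- have -> : f1 = (fun x => f x - f2 x).
    by apply/funext => x; rewrite fE addrK.
  rewrite convolutionBl//; last exact: Caaa_Cb.
  by apply/funext => x; rewrite subrK.
Qed.

End Convolution.

(** * Moderate and negligible nets under the operations, and their classes *)

Section NetOperations.
Variable R : realType.
Local Notation C := (Rcomplex R).
Implicit Types (u v w : net R) (X : set (R -> C)).

Definition mod_net u := forall j, mod_O (fun e => derive1n j (u e)).
Definition neg_net u := forall j, neg_O (fun e => derive1n j (u e)).

Lemma mod_O_leibniz (F G : nat -> net R) n :
  (forall i, mod_O (F i)) -> (forall i, mod_O (G i)) ->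
  mod_O (fun e => leibniz n (F^~ e) (G^~ e)).
Proof.
elim: n F G => [|n IH] F G mF mG /=; first exact: mod_OM.
by apply: mod_OD; apply: (IH (fun i => _) (fun i => _)) => i.
Qed.

Lemma neg_O_leibniz (F G : nat -> net R) n :
  (forall i, neg_O (F i)) -> (forall i, mod_O (G i)) ->
  neg_O (fun e => leibniz n (F^~ e) (G^~ e)).
Proof.
elim: n F G => [|n IH] F G mF mG /=; first exact: neg_OM.
by apply: neg_OD; apply: (IH (fun i => _) (fun i => _)) => i.
Qed.

Lemma smooth_in_moderate S u : smooth_in S `<=` @B R ->
  moderate +oo (smooth_in S) u <-> (forall e, smooth_in S (u e)) /\ mod_net u.
Proof.
move=> SB; split=> [mu|[Su mu]]; last exact: (moderate_ooP SB Su).2.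
have [Su _] := mu; split => //.
exact: (moderate_ooP SB Su).1.
Qed.

Lemma smooth_in_negligible S u : smooth_in S `<=` @B R ->
  negligible_net +oo (smooth_in S) u <->
  (forall e, smooth_in S (u e)) /\ neg_net u.
Proof.
move=> SB; split=> [nu|[Su nu]]; last exact: (negligible_ooP SB Su).2.
have [Su _] := nu; split => //.
exact: (negligible_ooP SB Su).1.
Qed.

Definition smooth_net u := forall e, smooth (u e).

Lemma mod_netD u v : smooth_net u -> smooth_net v -> mod_net u -> mod_net v ->
  mod_net (fun e x => u e x + v e x).
Proof.
move=> su sv mu mv j.
under [X in mod_O X]eq_fun do rewrite (smoothD (su _) (sv _)).2.
exact: mod_OD.
Qed.

Lemma neg_netD u v : smooth_net u -> smooth_net v -> neg_net u -> neg_net v ->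
  neg_net (fun e x => u e x + v e x).
Proof.
move=> su sv mu mv j.
under [X in neg_O X]eq_fun do rewrite (smoothD (su _) (sv _)).2.
exact: neg_OD.
Qed.

Lemma mod_netM u v : smooth_net u -> smooth_net v -> mod_net u -> mod_net v ->
  mod_net (fun e x => u e x * v e x).
Proof.
move=> su sv mu mv j.
under [X in mod_O X]eq_fun do rewrite (smoothM (su _) (sv _)).2.
exact: (mod_O_leibniz _ mu mv).
Qed.

Lemma neg_netM u v : smooth_net u -> smooth_net v -> neg_net u -> mod_net v ->
  neg_net (fun e x => u e x * v e x).
Proof.
move=> su sv mu mv j.
under [X in neg_O X]eq_fun do rewrite (smoothM (su _) (sv _)).2.
exact: (neg_O_leibniz _ mu mv).
Qed.

Lemma mod_net_cst (c : C) : mod_net (fun _ _ => c).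
Proof.
move=> j; under [X in mod_O X]eq_fun do rewrite (smooth_cst c).2.
exact: mod_O_cst.
Qed.

Lemma unif_O_translate (a : net R) t m :
  unif_O a m -> unif_O (fun e => translate t (a e)) m.
Proof.
move=> [K [d [d0 aK]]]; exists K, d; split => // e ed x.
exact: aK.
Qed.

Lemma mod_net_translate t u : smooth_net u -> mod_net u ->
  mod_net (fun e => translate t (u e)).
Proof.
move=> su mu j; have [m um] := mu j; exists m.
under [X in unif_O X]eq_fun do rewrite (smooth_translate t (su _)).2.
exact: unif_O_translate.
Qed.

Lemma neg_net_translate t u : smooth_net u -> neg_net u ->
  neg_net (fun e => translate t (u e)).
Proof.
move=> su nu j m.
under [X in unif_O X]eq_fun do rewrite (smooth_translate t (su _)).2.
exact: unif_O_translate (nu j m).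
Qed.

Lemma mod_net_derive k u : smooth_net u -> mod_net u ->
  mod_net (fun e => derive1n k (u e)).
Proof.
move=> su mu j.
under [X in mod_O X]eq_fun do rewrite (smooth_derive1n k (su _)).2.
exact: mu.
Qed.

Lemma neg_net_derive k u : smooth_net u -> neg_net u ->
  neg_net (fun e => derive1n k (u e)).
Proof.
move=> su nu j.
under [X in neg_O X]eq_fun do rewrite (smooth_derive1n k (su _)).2.
exact: nu.
Qed.

(** Young's inequality for a bounded and an integrable factor: the norms multiply, hence the orders
    add. *)
Lemma unif_O_convolution (a v : net R) (m n : int) :
  (forall e, Cb (a e)) -> (forall e, L1C (v e)) -> unif_O a m ->
  bigO_eps (fun e => LpNorm 1 (v e)) n ->
  unif_O (fun e => convolution (a e) (v e)) (m + n).
Proof.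
move=> ba L1v [K [d [d0 aK]]] [L [r [r0 vL]]].
exists (K * L *+ 2), (Num.min d r); rewrite lt_min d0 r0; split => // e.
rewrite lt_min => /andP[ed er] x.
rewrite expfzDr ?gt_eqF ?Ieps_gt0// mulrnAl mulrACA.
by apply: convolution_le => //; [exact: aK|exact: vL].
Qed.

(** All derivatives fall on [u], so the exponent for order [j] is that of the [j]-th derivative of
    [u] plus that of the [L^1] norm of [v]. *)
Lemma mod_net_convolution u v : (forall e, @B R (u e)) ->
  moderate 1 (DLp 1) v -> mod_net u ->
  mod_net (fun e => convolution (u e) (v e)).
Proof.
rewrite B_Cb => Bu [Dv /(_ 0%N)[n vn]] mu j.
have L1v e : L1C (v e) by exact: DLp1_L1C.
under [X in mod_O X]eq_fun do rewrite (smooth_convolution (Bu _) (L1v _)).2.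
have [m um] := mu j; exists (m + n)%N; rewrite PoszD opprD.
apply: unif_O_convolution => //; first by move=> e; have [] := Bu e.
by under [X in bigO_eps X]eq_fun do rewrite -DLp_norm0.
Qed.

Lemma neg_net_convolution u v : (forall e, @B R (u e)) ->
  moderate 1 (DLp 1) v -> neg_net u ->
  neg_net (fun e => convolution (u e) (v e)).
Proof.
rewrite B_Cb => Bu [Dv /(_ 0%N)[n vn]] nu j m.
have L1v e : L1C (v e) by exact: DLp1_L1C.
under [X in unif_O X]eq_fun do rewrite (smooth_convolution (Bu _) (L1v _)).2.
(* The target order [m] is split as [(m + n) - n]: the negligible net supplies [m + n], the moderate
   one costs [n]. *)
rewrite -(addrK n%:Z m%:Z).
apply: unif_O_convolution => //; first by move=> e; have [] := Bu e.
  exact: nu j (m + n)%N.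
by under [X in bigO_eps X]eq_fun do rewrite -DLp_norm0.
Qed.

Lemma convolution_neg_net u v : (forall e, @B R (u e)) ->
  negligible_net 1 (DLp 1) v -> mod_net u ->
  neg_net (fun e => convolution (u e) (v e)).
Proof.
rewrite B_Cb => Bu [Dv nv] mu j m.
have L1v e : L1C (v e) by exact: DLp1_L1C.
under [X in unif_O X]eq_fun do rewrite (smooth_convolution (Bu _) (L1v _)).2.
have [n un] := mu j.
rewrite -(addKr n%:Z m%:Z).
apply: unif_O_convolution => //; first by move=> e; have [] := Bu e.
under [X in bigO_eps X]eq_fun do rewrite -DLp_norm0.
exact: nv 0%N (n + m)%N.
Qed.

Definition negB := negligible_net +oo (@B R).

Lemma negBP u : negB u <-> (forall e, @B R (u e)) /\ neg_net u.
Proof.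
rewrite /negB B_Cb; apply: smooth_in_negligible.
by rewrite B_Cb; exact: subset_refl.
Qed.

Lemma modBP u : moderate +oo (@B R) u <-> (forall e, @B R (u e)) /\ mod_net u.
Proof.
rewrite B_Cb; apply: smooth_in_moderate.
by rewrite B_Cb; exact: subset_refl.
Qed.

Lemma negaaaP u : negligible_net +oo (@Baaa R) u <->
  (forall e, @Baaa R (u e)) /\ neg_net u.
Proof. exact: (smooth_in_negligible _ (@Baaa_B R)). Qed.

Lemma modaaaP u : moderate +oo (@Baaa R) u <->
  (forall e, @Baaa R (u e)) /\ mod_net u.
Proof. exact: (smooth_in_moderate _ (@Baaa_B R)). Qed.

Lemma B_smooth f : @B R f -> smooth f. Proof. by case. Qed.

Lemma BD f g : @B R f -> @B R g -> @B R (fun x => f x + g x).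
Proof. by rewrite B_Cb; apply: smooth_inD; exact: CbD. Qed.

Lemma BM f g : @B R f -> @B R g -> @B R (fun x => f x * g x).
Proof. by rewrite B_Cb; apply: smooth_inM; [exact: CbD|exact: CbM]. Qed.

Lemma B_cst (c : C) : @B R (fun=> c).
Proof. by rewrite B_Cb; apply: smooth_in_cst; exact: Cb_cst. Qed.

Lemma B_translate t f : @B R f -> @B R (translate t f).
Proof.
by rewrite B_Cb; apply: smooth_in_translate => a; exact: Cb_translate.
Qed.

Lemma B_derive k f : @B R f -> @B R (derive1n k f).
Proof. by rewrite B_Cb; exact: smooth_in_derive1n. Qed.

Lemma B_convolution f g : @B R f -> L1C g -> @B R (convolution f g).
Proof.
rewrite B_Cb => Bf L1g; have [s E] := smooth_convolution Bf L1g.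
by split => // j; rewrite E; apply: convolution_Cb => //; have [] := Bf.
Qed.

Lemma BaaaD f g : @Baaa R f -> @Baaa R g -> @Baaa R (fun x => f x + g x).
Proof. by apply: smooth_inD; exact: CaaaD. Qed.

Lemma BaaaM f g : @Baaa R f -> @Baaa R g -> @Baaa R (fun x => f x * g x).
Proof. by apply: smooth_inM; [exact: CaaaD|exact: CaaaM]. Qed.

Lemma Baa_cst (c : C) : @Baa R (fun=> c).
Proof. by apply: smooth_in_cst; exact: Caa_cst. Qed.

Lemma Baaa_cst (c : C) : @Baaa R (fun=> c).
Proof. exact/Baa_Baaa/Baa_cst. Qed.

Lemma Baaa_translate t f : @Baaa R f -> @Baaa R (translate t f).
Proof. by apply: smooth_in_translate => a; exact: Caaa_translate. Qed.

Lemma Baaa_convolution f g : @Baaa R f -> L1C g -> @Baaa R (convolution f g).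
Proof.
move=> /[dup] aaaf [sf af] L1g.
have Bf : smooth_in (@Cb R) f by rewrite -B_Cb; exact: Baaa_B.
have [s E] := smooth_convolution Bf L1g.
by split => // j; rewrite E; exact: convolution_Caaa.
Qed.

Lemma negBD u v : negB u -> negB v -> negB (fun e x => u e x + v e x).
Proof.
move=> /negBP[Bu nu] /negBP[Bv nv]; apply/negBP; split.
  by move=> e; exact: BD.
by apply: neg_netD => // e; exact: B_smooth.
Qed.

Lemma negBM u v : negB u -> moderate +oo (@B R) v ->
  negB (fun e x => u e x * v e x).
Proof.
move=> /negBP[Bu nu] /modBP[Bv nv]; apply/negBP; split.
  by move=> e; exact: BM.
by apply: neg_netM => // e; exact: B_smooth.
Qed.

Lemma negB_mod u : negB u -> moderate +oo (@B R) u.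
Proof.
by move=> /negBP[Bu nu]; apply/modBP; split => // j; exact/neg_mod_O/nu.
Qed.

Lemma mod_cst (c : C) : moderate +oo (@B R) (fun _ _ => c).
Proof. by apply/modBP; split=> [e|]; [exact: B_cst|exact: mod_net_cst]. Qed.

Lemma negBZ (c : C) u : negB u -> negB (fun e x => c * u e x).
Proof.
move=> nu; have := negBM nu (mod_cst c).
by congr negB; apply/funext => e; apply/funext => x; rewrite mulrC.
Qed.

Lemma neg_net0 : neg_net (fun _ _ => 0).
Proof.
move=> j m; exists 0, 1; split => // e _ x.
by rewrite (smooth_cst 0).2 mul0r; case: j => [|j]; rewrite normr0.
Qed.

Lemma modBD u v : moderate +oo (@B R) u -> moderate +oo (@B R) v ->
  moderate +oo (@B R) (fun e x => u e x + v e x).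
Proof.
move=> /modBP[Bu mu] /modBP[Bv mv]; apply/modBP; split.
  by move=> e; exact: BD.
by apply: mod_netD => // e; exact: B_smooth.
Qed.

Lemma net_class_refl p X u : negligible_net p X (fun _ _ => 0) ->
  net_class p X u u.
Proof.
rewrite /net_class/=; congr negligible_net.
by apply/funext => e; apply/funext => x; rewrite subrr.
Qed.

Lemma negB0 : negB (fun _ _ => 0).
Proof. by apply/negBP; split=> [e|]; [exact: B_cst|exact: neg_net0]. Qed.

Lemma negB_trans u v w : negB (fun e x => w e x - v e x) ->
  negB (fun e x => v e x - u e x) -> negB (fun e x => w e x - u e x).
Proof.
move=> wv vu; have := negBD wv vu.
by congr negB; apply/funext => e; apply/funext => x; rewrite addrA subrK.
Qed.

(** When [F] varies over [U] by negligible nets only, every class in the union lies in that of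
    [F u0]. Independence of representatives is thus reduced to one estimate for each operation. *)
Lemma on_class_eq (F : net R -> net R) (U : set (net R)) u0 : U u0 ->
  (forall u, U u -> negB (fun e x => F u e x - F u0 e x)) ->
  on_class F U = net_class +oo (@B R) (F u0).
Proof.
move=> Uu0 UF; apply/seteqP; split => w.
  by move=> [u Uu wu]; exact: negB_trans wu (UF u Uu).
by move=> wu0; exists u0.
Qed.

Lemma on_class2_eq (F : net R -> net R -> net R) (U V : set (net R)) u0 v0 :
  U u0 -> V v0 ->
  (forall u v, U u -> V v -> negB (fun e x => F u v e x - F u0 v0 e x)) ->
  on_class2 F U V = net_class +oo (@B R) (F u0 v0).
Proof.
move=> Uu0 Vv0 UVF; apply/seteqP; split => w.
  by move=> [u Uu [v Vv wu]]; exact: negB_trans wu (UVF u v Uu Vv).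
by move=> wu0; exists u0 => //; exists v0.
Qed.

(** A net negligible within the smaller space is negligible in [B], so all representatives have the
    same class there. The zero function in [S] ensures that [u] represents its own class. *)
Lemma to_GB_class S u : smooth_in S (fun=> 0) -> smooth_in S `<=` @B R ->
  to_GB (net_class +oo (smooth_in S) u) = net_class +oo (@B R) u.
Proof.
move=> S0 SB; apply: (on_class_eq (F := id)).
  apply: net_class_refl; apply/(smooth_in_negligible _ SB).
  by split => //; exact: neg_net0.
move=> v /(smooth_in_negligible _ SB)[Su nu]; apply/negBP; split => // e.
exact: SB.
Qed.

Lemma to_GB_aaaP W : (to_GB @` G_aaa R) W <->
  exists2 u, moderate +oo (@Baaa R) u & W = net_class +oo (@B R) u.
Proof.
have E u : to_GB (net_class +oo (@Baaa R) u) = net_class +oo (@B R) u.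
  by apply: to_GB_class; [exact: Baaa_cst|exact: Baaa_B].
split=> [[_ [u mu <-] <-]|[u mu ->]]; first by exists u.
by exists (net_class +oo (@Baaa R) u) => //; exists u.
Qed.

End NetOperations.

(** * The operations on classes and the embedding into the large algebra *)

Section Quotients.
Variable R : realType.
Local Notation C := (Rcomplex R).
Implicit Types (u v w : net R).

Lemma negaaaD u v : negligible_net +oo (@Baaa R) u ->
  negligible_net +oo (@Baaa R) v ->
  negligible_net +oo (@Baaa R) (fun e x => u e x + v e x).
Proof.
move=> /negaaaP[Bu nu] /negaaaP[Bv nv]; apply/negaaaP; split.
  by move=> e; exact: BaaaD.
by apply: neg_netD => // e; exact/B_smooth/Baaa_B.
Qed.

Lemma negaaa_trans u v w :
  negligible_net +oo (@Baaa R) (fun e x => w e x - v e x) ->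
  negligible_net +oo (@Baaa R) (fun e x => v e x - u e x) ->
  negligible_net +oo (@Baaa R) (fun e x => w e x - u e x).
Proof.
move=> wv vu; have := negaaaD wv vu.
congr negligible_net; apply/funext => e; apply/funext => x.
by rewrite addrA subrK.
Qed.

(** Negligibility is one and the same estimate [neg_net] in both spaces. Since [Baaa] is closed
    under differences, two of its nets that are equivalent in [B] are already equivalent in
    [Baaa]. *)
Lemma to_GB_inj (U V : set (net R)) : G_aaa R U -> G_aaa R V ->
  to_GB U = to_GB V -> U = V.
Proof.
suff sub u v : moderate +oo (@Baaa R) u -> moderate +oo (@Baaa R) v ->
    net_class +oo (@B R) u = net_class +oo (@B R) v ->
    net_class +oo (@Baaa R) u `<=` net_class +oo (@Baaa R) v.
  move=> [u mu <-] [v mv <-].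
  rewrite !(to_GB_class _ (@Baaa_cst R 0) (@Baaa_B R)).
  move=> E; apply/seteqP; split.
    exact: sub mu mv E.
  exact: sub mv mu (esym E).
move=> /modaaaP[Bu _] /modaaaP[Bv _] E w wu; apply: negaaa_trans wu _.
have /negBP[_ nuv] : net_class +oo (@B R) v u.
  by rewrite -E; apply: net_class_refl; exact: negB0.
apply/negaaaP; split => // e.
have -> : (fun x => u e x - v e x) = (fun x => u e x + -1 * v e x).
  by apply/funext => x; rewrite mulN1r.
by apply: BaaaD => //; apply: BaaaM => //; exact: Baaa_cst.
Qed.

Lemma modaaa_mod u : moderate +oo (@Baaa R) u -> moderate +oo (@B R) u.
Proof.
by move=> /modaaaP[Bu mu]; apply/modBP; split => // e; exact: Baaa_B.
Qed.

Lemma moderate_smooth u : moderate +oo (@B R) u -> smooth_net u.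
Proof. by move=> /modBP[Bu _] e; exact: B_smooth. Qed.

Lemma modaaaM u v : moderate +oo (@Baaa R) u -> moderate +oo (@Baaa R) v ->
  moderate +oo (@Baaa R) (fun e x => u e x * v e x).
Proof.
move=> /modaaaP[Bu mu] /modaaaP[Bv mv]; apply/modaaaP; split.
  by move=> e; exact: BaaaM.
by apply: mod_netM => // e; exact/B_smooth/Baaa_B.
Qed.

Lemma modaaa_cst (c : C) : moderate +oo (@Baaa R) (fun _ _ => c).
Proof.
by apply/modaaaP; split=> [e|]; [exact: Baaa_cst|exact: mod_net_cst].
Qed.

Lemma net_classB_refl u : net_class +oo (@B R) u u.
Proof. by apply: net_class_refl; exact: negB0. Qed.

Lemma net_class_mod u v : moderate +oo (@B R) v -> net_class +oo (@B R) v u ->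
  moderate +oo (@B R) u.
Proof.
move=> mv uv; have := modBD (negB_mod uv) mv.
by congr moderate; apply/funext => e; apply/funext => x; rewrite subrK.
Qed.

Lemma gaddE u v : gadd (net_class +oo (@B R) u) (net_class +oo (@B R) v) =
  net_class +oo (@B R) (fun e x => u e x + v e x).
Proof.
apply: on_class2_eq (net_classB_refl u) (net_classB_refl v) _.
move=> u' v' u'u v'v; have := negBD u'u v'v.
by congr negB; apply/funext => e; apply/funext => x; rewrite opprD addrACA.
Qed.

(** Independence of representatives rests on [u' v' - u v = (u' - u) v' + (v' - v) u], where [v'] is
    moderate like [v]. *)
Lemma gmulE u v : moderate +oo (@B R) u -> moderate +oo (@B R) v ->
  gmul (net_class +oo (@B R) u) (net_class +oo (@B R) v) =
  net_class +oo (@B R) (fun e x => u e x * v e x).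
Proof.
move=> mu mv; apply: on_class2_eq (net_classB_refl u) (net_classB_refl v) _.
move=> u' v' u'u v'v.
have := negBD (negBM u'u (net_class_mod mv v'v)) (negBM v'v mu).
congr negB; apply/funext => e; apply/funext => x.
by rewrite (mulrC _ (u e x)) mulrBl mulrBr addrA subrK.
Qed.

Lemma gscaleE (c : C) u : gscale c (net_class +oo (@B R) u) =
  net_class +oo (@B R) (fun e x => c * u e x).
Proof.
apply: on_class_eq (net_classB_refl u) _ => u' u'u; have := negBZ c u'u.
by congr negB; apply/funext => e; apply/funext => x; rewrite mulrBr.
Qed.

Lemma gtranslateE t u : gtranslate t (net_class +oo (@B R) u) =
  net_class +oo (@B R) (fun e => translate t (u e)).
Proof.
apply: on_class_eq (net_classB_refl u) _ => u' /negBP[Bd nd].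
apply/negBP; split=> [e|]; first exact: (B_translate t (Bd e)).
by apply: (neg_net_translate t _ nd) => e; exact: B_smooth.
Qed.

Lemma gderiveE j u : moderate +oo (@B R) u ->
  gderive j (net_class +oo (@B R) u) =
  net_class +oo (@B R) (fun e => derive1n j (u e)).
Proof.
move=> mu; apply: on_class_eq (net_classB_refl u) _ => u' u'u.
have su := moderate_smooth mu.
have su' := moderate_smooth (net_class_mod mu u'u).
have /negBP[Bd nd] := u'u.
(* The difference of derivatives becomes the derivative of the negligible net [u' - u]. *)
under [X in negB X]eq_fun do rewrite -(smoothB (su' _) (su _)).2.
apply/negBP; split=> [e|]; first exact: B_derive.
by apply: neg_net_derive => // e; exact: B_smooth.
Qed.

Lemma B_in_Cb (f : R -> C) : @B R f -> Cb f.
Proof. by rewrite B_Cb => -[_ /(_ 0%N)]. Qed.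

Lemma negL1_0 : negligible_net 1 (DLp 1) (fun _ _ => 0 : C).
Proof.
have [s E] := @smooth_cst R 0.
have E0 j : LpNorm 1 (derive1n j ((fun=> 0) : R -> C)) = 0%E.
  rewrite E /LpNorm -[RHS](@Lnorm0 _ _ _ (@lebesgue_measure R) 1%E)//.
  by apply: eq_Lnorm => x; case: j => [|j]; rewrite normr0.
split=> [e|k m]; first by split=> // j; rewrite E0 ltry.
exists 0, 1; split => // e _.
by rewrite mul0r /DLp_norm big1.
Qed.

(** The difference of two convolutions splits into [u'] convolved with [v' - v] and [u' - u]
    convolved with [v]. In each term one factor is negligible and the other moderate. *)
Lemma gconvE u v : moderate +oo (@B R) u -> moderate 1 (DLp 1) v ->
  gconv (net_class +oo (@B R) u) (net_class 1 (DLp 1) v) =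
  net_class +oo (@B R) (fun e => convolution (u e) (v e)).
Proof.
move=> mu mv.
have L1v e : L1C (v e) by apply: DLp1_L1C; have [] := mv.
apply: on_class2_eq (net_classB_refl u) _ _.
  by apply: net_class_refl; exact: negL1_0.
move=> u' v' u'u v'v.
have Bu e : @B R (u e) by have /modBP[] := mu.
have /modBP[Bu' mu'] := net_class_mod mu u'u.
have L1v' e : L1C (fun x => v' e x - v e x).
  by apply: DLp1_L1C; have [] := v'v.
have n1 : negB (fun e => convolution (fun x => u' e x - u e x) (v e)).
  move: u'u => /negBP[Bd nd]; apply/negBP; split=> [e|].
    exact: B_convolution (Bd e) (L1v e).
  exact: neg_net_convolution mv nd.
have n2 : negB (fun e => convolution (u' e) (fun x => v' e x - v e x)).
  apply/negBP; split=> [e|]; first exact: B_convolution.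
  exact: convolution_neg_net v'v mu'.
have := negBD n2 n1; congr negB; apply/funext => e; apply/funext => x.
rewrite (convolutionBl (B_in_Cb (Bu' e)) (B_in_Cb (Bu e)) (L1v e)).
have -> : convolution (u' e) (v' e) =
    (fun x => convolution (u' e) (fun x => v' e x - v e x) x +
              convolution (u' e) (v e) x).
  rewrite -(convolutionDr (B_in_Cb (Bu' e)) (L1v' e) (L1v e)).
  by congr convolution; apply/funext => y; rewrite subrK.
by rewrite /= addrA.
Qed.


Lemma modaaa_convolution u v : moderate +oo (@Baaa R) u ->
  moderate 1 (DLp 1) v ->
  moderate +oo (@Baaa R) (fun e => convolution (u e) (v e)).
Proof.
move=> /modaaaP[Bu mu] mv; apply/modaaaP; split=> [e|].
  by apply: Baaa_convolution => //; apply: DLp1_L1C; have [] := mv.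
by apply: mod_net_convolution => // e; exact: Baaa_B.
Qed.

End Quotients.

(** * The three closure properties, read off on moderate representatives *)

Theorem proposition5 (R : realType) :
  (* (1) *)
  ((forall U V : set (net R), G_aaa R U -> G_aaa R V -> to_GB U = to_GB V -> U = V) /\
   subalgebra_GB (to_GB @` G_aaa R) /\
   (forall (t : R) (U : set (net R)), (to_GB @` G_aaa R) U ->
      (to_GB @` G_aaa R) (gtranslate t U)) /\
   (forall (j : nat) (U : set (net R)), (to_GB @` G_aaa R) U ->
      (to_GB @` G_aaa R) (gderive j U))) /\
  (* (2) *)
  (forall U V : set (net R), G_aaa R U -> G_aa R V ->
      (to_GB @` G_aaa R) (gmul (to_GB U) (to_GB V))) /\
  (* (3) *)
  (forall U V : set (net R), G_aaa R U -> G_L1 R V ->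
      (to_GB @` G_aaa R) (gconv (to_GB U) V)).
Proof.
have aaa u : moderate +oo (@Baaa R) u ->
    (to_GB @` G_aaa R) (net_class +oo (@B R) u).
  by move=> mu; apply/to_GB_aaaP; exists u.
have aaaE u : to_GB (net_class +oo (@Baaa R) u) = net_class +oo (@B R) u.
  by apply: to_GB_class; [exact: Baaa_cst|exact: Baaa_B].
split; [split; [exact: to_GB_inj|split; [split|split]]|split].
- move=> _ /to_GB_aaaP[u mu ->]; exists u => //; exact: modaaa_mod.
- exact/aaa/modaaa_cst.
- move=> _ _ /to_GB_aaaP[u mu ->] /to_GB_aaaP[v mv ->]; rewrite gaddE.
  apply: aaa; move: mu mv => /modaaaP[Bu mu] /modaaaP[Bv mv].
  apply/modaaaP; split=> [e|]; first exact: BaaaD.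
  by apply: mod_netD => // e; exact/B_smooth/Baaa_B.
- move=> c _ /to_GB_aaaP[u mu ->]; rewrite gscaleE.
  (* Scaling is multiplication by a constant net. *)
  by apply: aaa; apply: modaaaM => //; exact: modaaa_cst.
- move=> _ _ /to_GB_aaaP[u mu ->] /to_GB_aaaP[v mv ->].
  rewrite gmulE; [|exact: modaaa_mod..].
  exact/aaa/modaaaM.
- move=> t _ /to_GB_aaaP[u /modaaaP[Bu mu] ->]; rewrite gtranslateE.
  apply/aaa/modaaaP; split=> [e|]; first exact: Baaa_translate.
  by apply: mod_net_translate => // e; exact/B_smooth/Baaa_B.
- move=> j _ /to_GB_aaaP[u mu ->]; rewrite gderiveE; last exact: modaaa_mod.
  apply: aaa; move: mu => /modaaaP[Bu mu].
  apply/modaaaP; split=> [e|]; first exact: (smooth_in_derive1n j (Bu e)).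
  by apply: mod_net_derive => // e; exact/B_smooth/Baaa_B.
- move=> _ _ [u mu <-] [v mv <-].
  (* Since [Baa] is contained in [Baaa], the second factor is itself a moderate net of [Baaa], and
     the product is one of two such nets. *)
  have mv' : moderate +oo (@Baaa R) v.
    have BaaB := subset_trans (@Baa_Baaa R) (@Baaa_B R).
    have [Bv mv'] := (smooth_in_moderate _ BaaB).1 mv.
    by apply/modaaaP; split => // e; exact: (Baa_Baaa (Bv e)).
  rewrite aaaE (to_GB_class _ (@Baa_cst R 0)); last first.
    exact: subset_trans (@Baa_Baaa R) (@Baaa_B R).
  rewrite gmulE; [|exact: modaaa_mod..].
  exact/aaa/modaaaM.
- move=> _ _ [u mu <-] [v mv <-]; rewrite aaaE gconvE//; last exact: modaaa_mod.
  exact/aaa/modaaa_convolution.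
Qed.
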